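(* Let $N_1$ and $N_2$ be ruled surfaces in $E^3$ forming a Mannheim offset, i.e. $N_2$ is a Mannheim offset of $N_1$. Then $N_1$ is a $q$-slant (or $a$-slant) ruled surface if and only if $N_2$ is an $h$-slant ruled surface. That is, each of the conditions ''$N_1$ is $q$-slant'' and ''$N_1$ is $a$-slant'' is equivalent to ''$N_2$ is $h$-slant''.
   Context: All maps are smooth and defined on open intervals; $E^3$ is Euclidean 3-space. All ruled surfaces $N$ considered are given by $\vec r(s,v)=\vec c(s)+v\vec q(s)$, where $\vec c$ is the striction curve (i.e. $\langle\vec c\,',\vec q\,'\rangle=0$), $s$ is its arc length parameter, and $\vec q$ is a unit vector field (the ruling). The Frenet frame of $N$ is $\{\vec q,\vec h,\vec a\}$ with $\vec a=\dfrac{\vec q\times\vec q\,'}{\|\vec q\,'\|}$ (central tangent) and $\vec h=\vec a\times\vec q$ (central normal). It satisfies $\vec q\,'=k_1\vec h$, $\vec h'=-k_1\vec q+k_2\vec a$, $\vec a'=-k_2\vec h$, and the invariants $k_1,k_2$ are assumed nowhere zero. $N$ is called $q$-slant (respectively $h$-slant, $a$-slant) if there is a fixed unit vector $\vec u$ and a constant angle $\theta\neq\pi/2$ such that $\langle\vec q,\vec u\rangle=\cos\theta$ (respectively $\langle\vec h,\vec u\rangle=\cos\theta$, $\langle\vec a,\vec u\rangle=\cos\theta$) along the striction curve. For two ruled surfaces $N_1,N_2$ with Frenet frames $\{\vec q_1,\vec h_1,\vec a_1\}$, $\{\vec q_2,\vec h_2,\vec a_2\}$, the surface $N_2$ is a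 Mannheim offset of $N_1$ if there is a one-to-one correspondence between the points of their striction curves such that $\vec a_1=\vec h_2$ at corresponding points. *)

(* Defs.v *)
From mathcomp Require Import all_boot all_order all_algebra.
From mathcomp Require Import all_classical all_reals all_analysis.

Set Implicit Arguments.
Unset Strict Implicit.
Unset Printing Implicit Defensive.

Import Order.TTheory GRing.Theory Num.Theory.
Import numFieldNormedType.Exports.

Local Open Scope classical_set_scope.
Local Open Scope ring_scope.

(* In ring_scope this notation otherwise means the derivative of a polynomial. *)
Local Notation "f ^` ()" := (derive1 f) : ring_scope.
Local Notation "f ^` ( n )" := (derive1n n f) : ring_scope.

(* Euclidean 3-space is 'rV[R]_3. The library norm on that type is the sup norm,
   which induces the same topology and derivatives; lengths are measured with
   [enorm] instead. *)
Definition dot (R : realType) (u v : 'rV[R]_3) : R :=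
  \sum_(i < 3) u 0 i * v 0 i.

Definition enorm (R : realType) (u : 'rV[R]_3) : R := Num.sqrt (dot u u).

(* Index addition in 'I_3 is modulo 3. *)
Definition cross (R : realType) (u v : 'rV[R]_3) : 'rV[R]_3 :=
  \row_(i < 3) (u 0 (i + 1) * v 0 (i + 2%:R) - u 0 (i + 2%:R) * v 0 (i + 1)).

Definition open_interval (R : realType) (I : set R) : Prop :=
  [/\ open I, is_interval I & I !=set0].

Definition smooth_on (R : realType) (I : set R) (f : R -> 'rV[R]_3) : Prop :=
  forall (n : nat) (s : R), I s -> derivable (f^`(n)) s 1.

(* Curves are total functions on R; only their values on the parameter
   interval matter. *)
Section Frenet.
Variables (R : realType) (q : R -> 'rV[R]_3).

Definition central_tangent (s : R) : 'rV[R]_3 :=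
  (enorm (q^`() s))^-1 *: cross (q s) (q^`() s).

Definition central_normal (s : R) : 'rV[R]_3 :=
  cross (central_tangent s) (q s).

(* The coefficients in q' = k1 h and h' = - k1 q + k2 a, read off from the
   orthonormality of {q, h, a}. If q' vanishes at s, then 0^-1 = 0 gives
   k1 = 0 there, so k1 <> 0 forces q' <> 0. *)
Definition invariant1 (s : R) : R := dot (q^`() s) (central_normal s).

Definition invariant2 (s : R) : R :=
  dot (central_normal^`() s) (central_tangent s).

End Frenet.

Record ruledSurface (R : realType) := RuledSurface {
  rs_dom : set R;
  rs_curve : R -> 'rV[R]_3;
  rs_ruling : R -> 'rV[R]_3;
  rs_dom_interval : open_interval rs_dom;
  rs_curve_smooth : smooth_on rs_dom rs_curve;
  rs_ruling_smooth : smooth_on rs_dom rs_ruling;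
  rs_arclength : forall s, rs_dom s -> enorm (rs_curve^`() s) = 1;
  rs_ruling_unit : forall s, rs_dom s -> enorm (rs_ruling s) = 1;
  rs_striction : forall s, rs_dom s ->
    dot (rs_curve^`() s) (rs_ruling^`() s) = 0;
  rs_invariant1 : forall s, rs_dom s -> invariant1 rs_ruling s <> 0;
  rs_invariant2 : forall s, rs_dom s -> invariant2 rs_ruling s <> 0
}.

Section Slant.
Variables (R : realType) (N : ruledSurface R).

Definition rs_point (s v : R) : 'rV[R]_3 := rs_curve N s + v *: rs_ruling N s.

Definition frame_q : R -> 'rV[R]_3 := rs_ruling N.
Definition frame_h : R -> 'rV[R]_3 := central_normal (rs_ruling N).
Definition frame_a : R -> 'rV[R]_3 := central_tangent (rs_ruling N).

Definition constant_angle (X : R -> 'rV[R]_3) : Prop :=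
  exists (u : 'rV[R]_3) (theta : R),
    [/\ enorm u = 1, 0 <= theta <= pi, theta <> pi / 2
      & forall s, rs_dom N s -> dot (X s) u = cos theta].

Definition q_slant : Prop := constant_angle frame_q.
Definition h_slant : Prop := constant_angle frame_h.
Definition a_slant : Prop := constant_angle frame_a.

End Slant.

(* [mannheim_offset N1 N2]: N2 is a Mannheim offset of N1. Points of a striction
   curve are identified by their parameter, since the curve may cross itself. *)
Definition mannheim_offset (R : realType) (N1 N2 : ruledSurface R) : Prop :=
  exists phi : R -> R, set_bij (rs_dom N1) (rs_dom N2) phi /\
    forall s, rs_dom N1 s -> frame_a N1 s = frame_h N2 (phi s).

(* Main.v *)
(** Because [a_1 = h_2] at corresponding points, "N1 is a-slant" and "N2 is
    h-slant" are the same condition on the same vector [u]. The remaining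
    equivalence between q-slant and a-slant follows from the Frenet formulas:
    if one of [<q, u>], [<a, u>] is constant then [<h, u> = 0] because [k1] and
    [k2] do not vanish, so the other one is constant too; moreover
    [0 = <h', u> = - k1 <q, u> + k2 <a, u>], so both constants are nonzero as
    soon as one of them is. *)

Require Import Defs.
From mathcomp Require Import all_boot all_order all_algebra.
From mathcomp Require Import all_classical all_reals all_analysis.
From mathcomp Require Import ring lra.

Set Implicit Arguments.
Unset Strict Implicit.
Unset Printing Implicit Defensive.

Import Order.TTheory GRing.Theory Num.Theory.
Import numFieldNormedType.Exports.

Local Open Scope classical_set_scope.
Local Open Scope ring_scope.

Local Notation "f ^` ()" := (derive1 f) : ring_scope.

(** * Dot and cross product identities, checked in coordinates *)

Section VectorAlgebra.
Variable R : realType.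
Implicit Types u v x y q a : 'rV[R]_3.

Lemma dotE u v :
  dot u v = u 0 0 * v 0 0 + u 0 1 * v 0 1 + u 0 2%:R * v 0 2%:R.
Proof.
rewrite /dot !big_ord_recl big_ord0 addr0 addrA.
have -> : lift ord0 ord0 = 1 :> 'I_3 by apply/val_inj.
by have -> : lift ord0 (lift ord0 ord0) = 2%:R :> 'I_3 by apply/val_inj.
Qed.

Lemma cross0E u v :
  cross u v 0 0 = u 0 1 * v 0 2%:R - u 0 2%:R * v 0 1.
Proof. by rewrite mxE !add0r. Qed.

Lemma cross1E u v :
  cross u v 0 1 = u 0 2%:R * v 0 0 - u 0 0 * v 0 2%:R.
Proof.
rewrite mxE.
have -> : 1 + 1 = 2%:R :> 'I_3 by apply/val_inj.
by have -> : 1 + 2%:R = 0 :> 'I_3 by apply/val_inj.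
Qed.

Lemma cross2E u v :
  cross u v 0 2%:R = u 0 0 * v 0 1 - u 0 1 * v 0 0.
Proof.
rewrite mxE.
have -> : 2%:R + 1 = 0 :> 'I_3 by apply/val_inj.
by have -> : 2%:R + 2%:R = 1 :> 'I_3 by apply/val_inj.
Qed.

Definition crossE := (cross0E, cross1E, cross2E).

Lemma dotC u v : dot u v = dot v u.
Proof. by rewrite !dotE; ring. Qed.

Lemma dotZl k u v : dot (k *: u) v = k * dot u v.
Proof. by rewrite !dotE !mxE; ring. Qed.

Lemma dot_ge0 u : 0 <= dot u u.
Proof. by apply: sumr_ge0 => i _; rewrite -expr2 sqr_ge0. Qed.

Lemma enormX2 u : enorm u ^+ 2 = dot u u.
Proof. by rewrite sqr_sqrtr ?dot_ge0. Qed.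

Lemma dot_cross_l u v : dot (cross u v) u = 0.
Proof. by rewrite dotE !crossE; ring. Qed.

Lemma dot_cross_r u v : dot (cross u v) v = 0.
Proof. by rewrite dotE !crossE; ring. Qed.

Lemma dot_cross_cross u v :
  dot (cross u v) (cross u v) = dot u u * dot v v - dot u v ^+ 2.
Proof. by rewrite !dotE !crossE; ring. Qed.

(* The product of the two triple products is the Gram determinant of
   (x, a, q) against (y, a, q). *)
Lemma parseval q a x y :
    dot q q = 1 -> dot a a = 1 -> dot a q = 0 ->
  dot x y = dot x q * dot y q + dot x (cross a q) * dot y (cross a q)
            + dot x a * dot y a.
Proof.
move=> qq aa aq.
have -> : dot x (cross a q) * dot y (cross a q) =
    dot x y * (dot a a * dot q q - dot a q ^+ 2)
    - dot x a * (dot y a * dot q q - dot a q * dot y q)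
    + dot x q * (dot y a * dot a q - dot a a * dot y q).
  by rewrite !dotE !crossE; ring.
by rewrite qq aa aq; ring.
Qed.

(** By Lagrange's identity, the gap between the two sides is the squared length of [cross u v]. *)
Lemma cauchy_schwarz u v : dot u v ^+ 2 <= dot u u * dot v v.
Proof. by rewrite -subr_ge0 -dot_cross_cross dot_ge0. Qed.

End VectorAlgebra.

(** * Differentiation of curves and of their dot products *)

Section CurveCalculus.
Variable R : realType.
Implicit Types (X Y : R -> 'rV[R]_3) (f : R -> R) (I : set R).

Lemma is_derive_coord X s j : derivable X s 1 ->
  is_derive s (1 : R) (fun t => X t 0 j) (X^`() s 0 j).
Proof.
move=> dX; rewrite derive1E derive_mx// mxE.
by apply: derivableP; apply: (derivable_mxP _ _ _).1.
Qed.

Lemma is_derive_dot X Y s : derivable X s 1 -> derivable Y s 1 ->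
  is_derive s (1 : R) (fun t => dot (X t) (Y t))
    (dot (X^`() s) (Y s) + dot (X s) (Y^`() s)).
Proof.
move=> dX dY.
have dXj j := is_derive_coord j dX.
have dYj j := is_derive_coord j dY.
under eq_fun do rewrite dotE.
have := is_deriveD (is_deriveD (is_deriveM (dXj 0) (dYj 0))
  (is_deriveM (dXj 1) (dYj 1))) (is_deriveM (dXj 2%:R) (dYj 2%:R)).
move/is_derive_eq; apply.
by rewrite !dotE /GRing.scale/=; ring.
Qed.

Lemma is_derive_dot_cst X u s : derivable X s 1 ->
  is_derive s (1 : R) (fun t => dot (X t) u) (dot (X^`() s) u).
Proof.
move=> dX; have := is_derive_dot dX (derivable_cst u s 1).
move/is_derive_eq; apply; rewrite derive1_cst.
by rewrite [dot (X s) _]dotE !mxE !mulr0 !addr0.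
Qed.

Lemma derivable_cross X Y s : derivable X s 1 -> derivable Y s 1 ->
  derivable (fun t => cross (X t) (Y t)) s 1.
Proof.
move=> /derivable_mxP dX /derivable_mxP dY.
apply/derivable_mxP => i j.
under eq_fun do rewrite mxE.
by apply: derivableB; apply: derivableM.
Qed.

Lemma derivable_scale f X s : derivable f s 1 -> derivable X s 1 ->
  derivable (fun t => f t *: X t) s 1.
Proof.
move=> df /derivable_mxP dX; apply/derivable_mxP => i j.
under eq_fun do rewrite mxE.
exact: derivableM.
Qed.

Lemma derivable_enorm X s : derivable X s 1 -> enorm (X s) <> 0 ->
  derivable (fun t => enorm (X t)) s 1.
Proof.
move=> dX nX0.
have X_gt0 : 0 < dot (X s) (X s).
  by rewrite -enormX2 exprn_even_gt0//=; apply/eqP.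
exact: (@ex_derive _ _ _ _ _ _ _
  (is_derive1_comp (is_derive1_sqrt X_gt0) (is_derive_dot dX dX))).
Qed.

(** Since [I] is open, [f] agrees with a constant function near [s], and a derivative depends only
    on values near the point. *)
Lemma is_derive_cst_on I f s (c df : R) : open I -> I s ->
  (forall t, I t -> f t = c) -> is_derive s (1 : R) f df -> df = 0.
Proof.
move=> oI Is fc dfE.
have -> : df = 'D_1 f s by rewrite (@derive_val _ _ _ _ _ _ _ dfE).
rewrite -(derive_cst c s (1 : R)); apply: near_eq_derive.
by near=> t; apply: fc; near: t; exact: open_nbhs_nbhs.
Unshelve. all: by end_near. Qed.

(** Product rule. Applied to the vectors of an orthonormal frame, it makes the matrix of the Frenet
    equations skew-symmetric; [X = Y] gives its zero diagonal. *)
Lemma dot_cst_derive I X Y s (c : R) : open I -> I s ->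
    derivable X s 1 -> derivable Y s 1 ->
    (forall t, I t -> dot (X t) (Y t) = c) ->
  dot (X^`() s) (Y s) = - dot (Y^`() s) (X s).
Proof.
move=> oI Is dX dY XYc; apply/eqP; rewrite -addr_eq0 (dotC _ (X s)).
exact/eqP/(is_derive_cst_on oI Is XYc)/is_derive_dot.
Qed.

Lemma is_derive0_cst_on I f : is_interval I ->
    (forall s, I s -> is_derive s (1 : R) f 0) ->
  forall s t, I s -> I t -> f s = f t.
Proof.
move=> itvI df0 s t Is It.
wlog st : s t Is It / s <= t.
  by case/orP: (le_total s t) => st H; [|symmetry]; apply: H.
(* The mean value theorem needs the whole segment between [s] and [t] to lie in [I]. *)
have Iin x : x \in `[s, t]%R -> I x by rewrite in_itv/=; exact: itvI.
have [x xst||c _] := @MVT_segment R f (cst 0) s t st; last 1 first.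
- by rewrite mul0r => /eqP; rewrite subr_eq0 => /eqP.
- by apply: df0; apply: Iin; apply: subset_itv_oo_cc.
- apply: derivable_within_continuous => x /Iin Ix.
  by case: (df0 x Ix).
Qed.

End CurveCalculus.

(** * The Frenet formulas, paired with a fixed vector [u] *)

Section FrenetFormulas.
Variables (R : realType) (N : ruledSurface R).

Local Notation I := (rs_dom N).
Local Notation q := (rs_ruling N).
Local Notation h := (central_normal (rs_ruling N)).
Local Notation a := (central_tangent (rs_ruling N)).
Local Notation k1 := (invariant1 (rs_ruling N)).
Local Notation k2 := (invariant2 (rs_ruling N)).

Let openI : open I. Proof. by case: (rs_dom_interval N). Qed.

Lemma derivable_ruling s : I s -> derivable q s 1.
Proof. exact: (rs_ruling_smooth (n := 0%N)). Qed.

Lemma derivable_ruling' s : I s -> derivable q^`() s 1.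
Proof. exact: (rs_ruling_smooth (n := 1%N)). Qed.

Lemma dot_qq s : I s -> dot (q s) (q s) = 1.
Proof. by move=> Is; rewrite -enormX2 rs_ruling_unit// expr1n. Qed.

Lemma dot_q'q s : I s -> dot (q^`() s) (q s) = 0.
Proof.
move=> Is; have dq := derivable_ruling Is.
by have := dot_cst_derive openI Is dq dq dot_qq; lra.
Qed.

(** Otherwise the convention [0^-1 = 0] makes [a s] vanish, hence also [h s] and [k1 s]. *)
Lemma enorm_q'_neq0 s : I s -> enorm (q^`() s) <> 0.
Proof.
move=> Is q'0; apply: (rs_invariant1 Is).
rewrite /invariant1 /central_normal /central_tangent q'0 invr0.
by rewrite scale0r dotC dotE !crossE !mxE; ring.
Qed.

Lemma derivable_central_tangent s : I s -> derivable a s 1.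
Proof.
move=> Is; have dq' := derivable_ruling' Is.
have nq'0 := enorm_q'_neq0 Is.
apply: derivable_scale; last exact: derivable_cross (derivable_ruling Is) dq'.
by apply: derivableV; [exact/eqP|exact: derivable_enorm].
Qed.

Lemma derivable_central_normal s : I s -> derivable h s 1.
Proof.
by move=> Is; apply: derivable_cross;
  [exact: derivable_central_tangent|exact: derivable_ruling].
Qed.

Lemma dot_aq s : dot (a s) (q s) = 0.
Proof. by rewrite dotZl dot_cross_l mulr0. Qed.

Lemma dot_aq' s : dot (a s) (q^`() s) = 0.
Proof. by rewrite dotZl dot_cross_r mulr0. Qed.

Lemma dot_ah s : dot (a s) (h s) = 0.
Proof. by rewrite dotC dot_cross_l. Qed.

Lemma dot_hq s : dot (h s) (q s) = 0.
Proof. exact: dot_cross_r. Qed.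

(** As [q] is a unit vector orthogonal to its derivative, Lagrange's identity gives [cross q q'] the
    length of [q'], which is the normalizing factor in [a]. *)
Lemma dot_aa s : I s -> dot (a s) (a s) = 1.
Proof.
move=> Is; rewrite dotZl dotC dotZl dot_cross_cross dot_qq// mul1r.
rewrite (dotC (q s)) dot_q'q// -enormX2.
by have := enorm_q'_neq0 Is; move/eqP => ?; field.
Qed.

Lemma dot_hh s : I s -> dot (h s) (h s) = 1.
Proof. by move=> Is; rewrite dot_cross_cross dot_aq dot_aa// dot_qq//; ring. Qed.

(** With [x] the derivative of a frame vector and [y = u], this reduces each Frenet formula to
    finding three coefficients. *)
Lemma frame_parseval s x y : I s ->
  dot x y = dot x (q s) * dot y (q s) + dot x (h s) * dot y (h s)
            + dot x (a s) * dot y (a s).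
Proof.
by move=> Is; apply: parseval; [exact: dot_qq|exact: dot_aa|exact: dot_aq].
Qed.

Variable u : 'rV[R]_3.

Lemma is_derive_dot_q s : I s ->
  is_derive s (1 : R) (fun t => dot (q t) u) (k1 s * dot (h s) u).
Proof.
move=> Is; apply: is_derive_eq (is_derive_dot_cst u (derivable_ruling Is)) _.
rewrite (frame_parseval _ _ Is) dot_q'q// (dotC _ (a s)) dot_aq'.
by rewrite (dotC u (h s)) /invariant1; ring.
Qed.

Lemma is_derive_dot_h s : I s ->
  is_derive s (1 : R) (fun t => dot (h t) u)
    (- k1 s * dot (q s) u + k2 s * dot (a s) u).
Proof.
move=> Is; have dh := derivable_central_normal Is.
apply: is_derive_eq (is_derive_dot_cst u dh) _.
rewrite (frame_parseval _ _ Is) !(dotC u).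
have h'h : dot (h^`() s) (h s) = 0.
  by have := dot_cst_derive openI Is dh dh dot_hh; lra.
(* Differentiating [dot h q = 0] moves the derivative onto [q], where [k1] is defined; the
   coefficient on [a] is [k2] by definition. *)
have h'q : dot (h^`() s) (q s) = - k1 s.
  exact: dot_cst_derive openI Is dh (derivable_ruling Is) (fun t _ => dot_hq t).
by rewrite h'h h'q /invariant2; ring.
Qed.

Lemma is_derive_dot_a s : I s ->
  is_derive s (1 : R) (fun t => dot (a t) u) (- k2 s * dot (h s) u).
Proof.
move=> Is; have da := derivable_central_tangent Is.
apply: is_derive_eq (is_derive_dot_cst u da) _.
rewrite (frame_parseval _ _ Is) !(dotC u).
have a'a : dot (a^`() s) (a s) = 0.
  by have := dot_cst_derive openI Is da da dot_aa; lra.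
(* Here the derivative moves onto [q], and [a] is a multiple of [cross q q'], hence orthogonal to
   [q']. *)
have a'q : dot (a^`() s) (q s) = 0.
  have -> := dot_cst_derive openI Is da (derivable_ruling Is) (fun t _ => dot_aq t).
  by rewrite dotC dot_aq' oppr0.
have a'h : dot (a^`() s) (h s) = - k2 s.
  exact: dot_cst_derive openI Is da (derivable_central_normal Is)
    (fun t _ => dot_ah t).
by rewrite a'a a'q a'h; ring.
Qed.

Lemma dot_h_eq0_relation : (forall s, I s -> dot (h s) u = 0) ->
  forall s, I s -> k1 s * dot (q s) u = k2 s * dot (a s) u.
Proof.
move=> hu0 s Is.
have := is_derive_cst_on openI Is hu0 (is_derive_dot_h Is); lra.
Qed.

End FrenetFormulas.

(** * Slant conditions as constancy of a nonzero dot product *)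

Section Slant.
Variables (R : realType) (N : ruledSurface R).
Implicit Types X : R -> 'rV[R]_3.

(** Injectivity of [cos] on [[0, pi]] turns [theta <> pi / 2] into a nonzero cosine. *)
Lemma constant_angle_dot X : constant_angle N X ->
  exists (u : 'rV[R]_3) (c : R), [/\ enorm u = 1, c <> 0
    & forall s, rs_dom N s -> dot (X s) u = c].
Proof.
move=> [u [theta [u1 /andP[t0 tpi] tnpi Xu]]]; exists u, (cos theta); split=> //.
rewrite -cos_pihalf => /cos_inj tE; apply: tnpi; apply: tE.
  by rewrite in_itv/= t0.
by rewrite in_itv/= divr_ge0 ?pi_ge0// ler_pdivrMr// ler_peMr ?pi_ge0// ler1n.
Qed.

(** The angle is the [acos] of the common value, taken at a point of the nonempty domain;
    Cauchy-Schwarz bounds that value by 1 in absolute value, so [cos] recovers it. *)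
Lemma dot_constant_angle X (u : 'rV[R]_3) :
    (forall s, rs_dom N s -> dot (X s) (X s) = 1) -> enorm u = 1 ->
    (forall s, rs_dom N s -> dot (X s) u <> 0) ->
    (forall s t, rs_dom N s -> rs_dom N t -> dot (X s) u = dot (X t) u) ->
  constant_angle N X.
Proof.
move=> XX u1 Xu0 Xuc; have [_ _ [s Is]] := rs_dom_interval N.
set c := dot (X s) u.
have c1 : -1 <= c <= 1.
  have := cauchy_schwarz (X s) u.
  by rewrite XX// -enormX2 u1 expr1n mulr1 -/c => ?; apply/andP; split; nra.
have acosKc : cos (acos c) = c by apply: acosK; rewrite in_itv.
exists u, (acos c); split => //.
- by rewrite acos_ge0//= acos_lepi.
- by move=> cE; apply: (Xu0 s Is); rewrite -/c -acosKc cE cos_pihalf.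
- by move=> t It; rewrite acosKc; exact: Xuc.
Qed.

Lemma q_slant_iff_a_slant : q_slant N <-> a_slant N.
Proof.
have [oI itvI _] := rs_dom_interval N.
split=> /constant_angle_dot[u [c [u1 c0 Xu]]].
- have hu0 s : rs_dom N s -> dot (frame_h N s) u = 0.
    move=> Is; have /eqP := is_derive_cst_on oI Is Xu (is_derive_dot_q u Is).
    by rewrite mulf_eq0 => /orP[|]/eqP// /(rs_invariant1 Is).
  apply: (@dot_constant_angle (frame_a N) u _ u1).
  + by move=> s; exact: dot_aa.
  (* A zero of [dot a u] would force [k1 s * c = 0], with both factors nonzero. *)
  + move=> s Is au0; have := dot_h_eq0_relation hu0 Is.
    rewrite Xu// au0 mulr0 => /eqP; rewrite mulf_eq0 => /orP[|]/eqP//.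
    exact: rs_invariant1.
  + apply: is_derive0_cst_on => // s Is.
    by apply: is_derive_eq (is_derive_dot_a u Is) _; rewrite hu0// mulr0.
- have hu0 s : rs_dom N s -> dot (frame_h N s) u = 0.
    move=> Is; have /eqP := is_derive_cst_on oI Is Xu (is_derive_dot_a u Is).
    by rewrite mulf_eq0 oppr_eq0 => /orP[|]/eqP// /(rs_invariant2 Is).
  apply: (@dot_constant_angle (frame_q N) u _ u1).
  + by move=> s; exact: dot_qq.
  + move=> s Is qu0; have := dot_h_eq0_relation hu0 Is.
    rewrite qu0 Xu// mulr0 => /esym/eqP; rewrite mulf_eq0 => /orP[|]/eqP//.
    exact: rs_invariant2.
  + apply: is_derive0_cst_on => // s Is.
    by apply: is_derive_eq (is_derive_dot_q u Is) _; rewrite hu0// mulr0.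
Qed.

End Slant.

(** The same [u] and [theta] serve on both sides: surjectivity of [phi] reaches every point of the
    domain of [N2], and conversely [phi] sends the domain of [N1] into it. *)
Lemma a_slant_iff_offset_h_slant (R : realType) (N1 N2 : ruledSurface R) :
  mannheim_offset N1 N2 -> a_slant N1 <-> h_slant N2.
Proof.
move=> [phi [[phiI _ phi_surj] ah]].
split=> -[u [theta [u1 t0 tn Xu]]]; exists u, theta; split=> // s Is.
- by have [t It <-] := phi_surj s Is; rewrite -ah// Xu.
- by rewrite ah// Xu//; exact: phiI.
Qed.

Theorem corollary5p2 (R : realType) (N1 N2 : ruledSurface R) :
  mannheim_offset N1 N2 ->
  (q_slant N1 <-> h_slant N2) /\ (a_slant N1 <-> h_slant N2).
Proof.
move=> N12; have ah := a_slant_iff_offset_h_slant N12.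
by split=> //; exact: iff_trans (q_slant_iff_a_slant N1) ah.
Qed.
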